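(* Let $D$ be the graph (the $1$-skeleton) of the dodecahedron. Then $\mathrm{obs}(D) = \mathrm{obs}_{\mathrm{out}}(D) = 1$.
   Context: All graphs are finite, simple, and undirected. A straight-line drawing of a graph $G$ in the plane places the vertices at distinct points of $\mathbb{R}^2$ and draws each edge as the closed line segment joining its endpoints; the drawing is regarded as the union of all vertex points and edge segments. A non-edge of $G$ is a pair of distinct vertices $a,b$ such that $ab$ is not an edge of $G$; in a drawing it is identified with the line segment joining $a$ and $b$. An obstacle representation of $G$ is a straight-line drawing of $G$ in the plane together with a collection of connected subsets of the plane, called obstacles, such that no obstacle meets the drawing of $G$, while every non-edge of $G$ intersects at least one obstacle. The obstacle number $\mathrm{obs}(G)$ is the least number of obstacles in an obstacle representation of $G$. An outside obstacle is an obstacle contained in the unbounded component of the complement of the drawing of $G$. The outside obstacle number $\mathrm{obs}_{\mathrm{out}}(G)$ is the least number of obstacles in an obstacle representation of $G$ in which one of the obstacles is an outside obstacle, or zero if $\mathrm{obs}(G)=0$. *)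

(* Defs.v *)
From HB Require Import structures.
From mathcomp Require Import all_boot all_order all_algebra.
From mathcomp Require Import all_classical all_reals all_analysis.

Set Implicit Arguments.
Unset Strict Implicit.
Unset Printing Implicit Defensive.

Import Order.TTheory GRing.Theory Num.Theory.
Import numFieldNormedType.Exports.

Local Open Scope classical_set_scope.
Local Open Scope ring_scope.

Record sgraph := SGraph {
  vertex : finType;
  edge : rel vertex;
  edge_sym : symmetric edge;
  edge_irrefl : irreflexive edge }.

Section Obstacles.
Variables (R : realType) (G : sgraph).

Definition segment (a b : R * R) : set (R * R) :=
  [set (1 - t) *: a + t *: b | t in [set t : R | 0 <= t <= 1]].

(* Distinct vertex points are the only requirement: no general position is
   assumed, so a vertex may lie on a segment and segments may overlap. *)
Definition straight_line_drawing (pos : vertex G -> R * R) : Prop :=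
  injective pos.

Definition drawing (pos : vertex G -> R * R) : set (R * R) :=
  [set p | (exists v, p = pos v) \/
           (exists u v, edge u v /\ segment (pos u) (pos v) p)].

Definition obstacle_representation (pos : vertex G -> R * R)
    (k : nat) (obs : 'I_k -> set (R * R)) : Prop :=
  [/\ straight_line_drawing pos,
      forall i, connected (obs i),
      forall i, obs i `&` drawing pos = set0 &
      forall a b, a != b -> ~~ edge a b ->
        exists i, obs i `&` segment (pos a) (pos b) !=set0].

(* p is a point of the complement whose component is the unbounded one. *)
Definition outside_obstacle (pos : vertex G -> R * R) (O : set (R * R)) : Prop :=
  exists p, [/\ (~` drawing pos) p,
    ~ bounded_set (connected_component (~` drawing pos) p) &
    O `<=` connected_component (~` drawing pos) p].

Definition has_obstacle_rep (k : nat) : Prop :=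
  exists pos (obs : 'I_k -> set (R * R)), obstacle_representation pos obs.

Definition has_outside_obstacle_rep (k : nat) : Prop :=
  exists pos (obs : 'I_k -> set (R * R)),
    obstacle_representation pos obs /\ exists i, outside_obstacle pos (obs i).

(* The default 0 is returned by xget only when P is empty, in particular when 0
   is not in P; a value of 1 therefore really is a minimum. *)
Definition least (P : set nat) : nat :=
  xget 0%N [set k | P k /\ forall j, P j -> (k <= j)%N].

Definition obstacle_number : nat := least has_obstacle_rep.

Definition outside_obstacle_number : nat :=
  if obstacle_number == 0%N then 0%N else least has_outside_obstacle_rep.

End Obstacles.

(* The boundary cycles of the 12 pentagonal faces: the top face, the five faces
   adjacent to it, the five faces adjacent to the bottom face, the bottom
   face. *)
Definition dodecahedron_faces : seq (seq nat) :=
  [:: [:: 0; 1; 2; 3; 4];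
      [:: 0; 1; 6; 10; 5];
      [:: 1; 2; 7; 11; 6];
      [:: 2; 3; 8; 12; 7];
      [:: 3; 4; 9; 13; 8];
      [:: 4; 0; 5; 14; 9];
      [:: 10; 6; 11; 16; 15];
      [:: 11; 7; 12; 17; 16];
      [:: 12; 8; 13; 18; 17];
      [:: 13; 9; 14; 19; 18];
      [:: 14; 5; 10; 15; 19];
      [:: 15; 16; 17; 18; 19] ]%N.

(* x and y are cyclically consecutive in f *)
Definition side_of (x y : nat) (f : seq nat) : bool :=
  ((x, y) \in zip f (rot 1 f)) || ((y, x) \in zip f (rot 1 f)).

Definition dodecahedron_edge : rel 'I_20 :=
  fun x y => has (side_of x y) dodecahedron_faces.

Lemma dodecahedron_edge_sym : symmetric dodecahedron_edge.
Proof. by move=> x y; apply: eq_has => f; rewrite /side_of orbC. Qed.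

Lemma dodecahedron_edge_irrefl : irreflexive dodecahedron_edge.
Proof.
suff irr : all (fun x => ~~ has (side_of x x) dodecahedron_faces) (iota 0 20).
  move=> x; apply/negbTE; move/allP: irr; apply.
  by rewrite mem_iota /= add0n ltn_ord.
by vm_compute.
Qed.

Definition dodecahedron : sgraph :=
  SGraph dodecahedron_edge_sym dodecahedron_edge_irrefl.

(* Every vertex has degree 3 and lies on 3 faces, and every edge is a side of
   exactly two faces, so the face list is a closed surface with V - E + F =
   20 - 30 + 12 = 2. *)
Lemma dodecahedron_faces_sane :
  let V := iota 0 20 in let F := dodecahedron_faces in
  [&& size F == 12%N, all (fun f => uniq f && (size f == 5%N)) F,
      all (fun f => all (fun x => x \in V) f) F,
      all (fun x => count (fun y => has (side_of x y) F) V == 3%N) V,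
      all (fun x => count (fun f => x \in f) F == 3%N) V &
      all (fun x => all (fun y => has (side_of x y) F ==>
        (count (side_of x y) F == 2%N)) V) V].
Proof. by vm_compute. Qed.

(* Main.v *)
From Corelib Require Import BinNums.
Require Import Defs.
From mathcomp Require Import all_boot all_order all_algebra.
From mathcomp Require Import all_classical all_reals all_analysis.
From mathcomp Require Import ssrZ ring lra.

(** The graph has non-edges, so no representation is without obstacles, and it
    suffices to exhibit one representation whose only obstacle lies in the
    unbounded face of the drawing.

    Such a drawing cannot be planar, nor resemble the usual pictures of the
    dodecahedron.  An induced pentagon drawn as a simple polygon has a diagonal
    inside it, and an obstacle in the unbounded face cannot reach that diagonal;
    hence none of the twelve faces may be drawn as a simple polygon.  The
    drawing below, [dodecahedron_points], was found by a computer search over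
    point sets in an integer grid for one in which every non-edge passes through
    the unbounded face.  The obstacle is a polygonal path that winds around the
    drawing in this face and dips into its pockets, crossing all the non-edges on
    the way.

    What has to be checked is then a finite list of statements about pairs of
    segments with integer endpoints: the sides of the path miss the edges and
    each non-edge meets a side of the path.  Both are decided by the signs of
    the determinants [orient] ([separated_disjoint], [crossing_meet]), and
    [drawing_certificate] evaluates all of these signs on binary integers.  The
    path is connected as a chain of segments; it lies in the unbounded face
    because it has a vertex below the whole drawing, from which one can go
    straight down to infinity ([outside_of_below]). *)

Set Implicit Arguments.
Unset Strict Implicit.
Unset Printing Implicit Defensive.

Import Order.TTheory GRing.Theory Num.Theory.
Import numFieldNormedType.Exports.

Local Open Scope classical_set_scope.
Local Open Scope ring_scope.

(** * Sign tests for pairs of segments *)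

Section Orientation.
Variable R : realDomainType.
Implicit Types a b c d : R * R.

(** Twice the signed area of the triangle [a b c]; its sign tells on which side
    of the line [a b] the point [c] lies. *)
Definition orient a b c : R :=
  (b.1 - a.1) * (c.2 - a.2) - (b.2 - a.2) * (c.1 - a.1).

(** One of the two segments lies strictly on one side of the line through the
    other one. *)
Definition separated_segments a b c d : bool :=
  (0 < orient a b c * orient a b d) || (0 < orient c d a * orient c d b).

(** Each of the two segments meets the line through the other one.  The last
    clause says that the lines are not parallel; without it, disjoint segments
    of one line would qualify. *)
Definition crossing a b c d : bool :=
  [&& orient a b c * orient a b d <= 0, orient c d a * orient c d b <= 0
    & orient a b c != orient a b d].

Lemma orient_affine a b c d (t : R) :
  orient a b ((1 - t) * c.1 + t * d.1, (1 - t) * c.2 + t * d.2) =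
  (1 - t) * orient a b c + t * orient a b d.
Proof. by rewrite /orient /=; ring. Qed.

(** Both sides are the cross product of the directions [b - a] and [d - c]. *)
Lemma orient_cross a b c d :
  orient c d a - orient c d b = orient a b d - orient a b c.
Proof. by rewrite /orient; ring. Qed.

End Orientation.

Section Segments.
Variable R : realType.
Implicit Types a b c d p : R * R.

Lemma segmentP a b p : segment a b p <->
  exists2 t : R, 0 <= t <= 1 &
    p = ((1 - t) * a.1 + t * b.1, (1 - t) * a.2 + t * b.2).
Proof. by split=> [[t t01 <-]|[t t01 ->]]; exists t. Qed.

Lemma segment_left a b : segment a b a.
Proof.
apply/segmentP; exists 0; first by rewrite lexx ler01.
by rewrite !subr0 !mul1r !mul0r !addr0; case: a.
Qed.

Lemma segment_right a b : segment a b b.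
Proof.
apply/segmentP; exists 1; first by rewrite lexx ler01.
by rewrite !subrr !mul1r !mul0r !add0r; case: b.
Qed.

Lemma connected_segment a b : connected (segment a b).
Proof.
apply: connected_continuous_connected; first exact: segment_connected.
apply: continuous_subspaceT => t; apply: cvgD; apply: cvgZl => //.
by apply: cvgB => //; exact: cvg_cst.
Qed.

Lemma segment_snd_gt0 a b p : 0 < a.2 -> 0 < b.2 -> segment a b p -> 0 < p.2.
Proof. by move=> a0 b0 /segmentP[t /andP[t0 t1] -> /=]; nra. Qed.

Lemma segment_snd_le0 a b p : a.2 <= 0 -> b.2 <= 0 -> segment a b p -> p.2 <= 0.
Proof. by move=> a0 b0 /segmentP[t /andP[t0 t1] -> /=]; nra. Qed.

Lemma orient_segment a b c d p : segment c d p ->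
  exists2 t : R, 0 <= t <= 1 &
    orient a b p = (1 - t) * orient a b c + t * orient a b d.
Proof. by move=> /segmentP[t t01 ->]; exists t; rewrite ?orient_affine. Qed.

Lemma orient_self a b p : segment a b p -> orient a b p = 0.
Proof. by case/(orient_segment a b) => t _ ->; rewrite /orient; ring. Qed.

(** [orient a b] vanishes on the segment [a b], while on the segment [c d] it is
    a convex combination of two numbers of the same sign. *)
Lemma same_side_disjoint a b c d :
  0 < orient a b c * orient a b d -> segment a b `&` segment c d = set0.
Proof.
move=> cd; rewrite -subset0 => p [/orient_self abp /(orient_segment a b)[t]].
rewrite {}abp; move: (orient a b c) (orient a b d) cd => u v uv /andP[t0 t1] e.
(* Multiplied by u, both terms of the combination become nonnegative. *)
have eu : (1 - t) * u ^+ 2 + t * (u * v) = 0.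
  by rewrite -(mul0r u) [in RHS]e; ring.
have uu : 0 < u ^+ 2.
  by rewrite exprn_even_gt0 //=; apply: contraTneq uv => ->; rewrite mul0r ltxx.
have [t_le0|t_gt0] := leP t 0.
  have t00 : t = 0 by lra.
  by move: eu uu; rewrite t00 subr0 mul1r mul0r addr0 => ->; rewrite ltxx.
have tuv : 0 < t * (u * v) by exact: mulr_gt0.
have : 0 <= (1 - t) * u ^+ 2 by rewrite mulr_ge0 ?subr_ge0 // ltW.
lra.
Qed.

Lemma separated_disjoint a b c d : separated_segments a b c d ->
  segment a b `&` segment c d = set0.
Proof. by case/orP=> /same_side_disjoint // ?; rewrite setIC. Qed.

(** An affine function with end values [u] and [v] of opposite signs vanishes at
    the parameter [u / (u - v)] of the unit interval. *)
Lemma zero_parameter01 (u v : R) : u * v <= 0 -> u != v ->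
  0 <= u / (u - v) <= 1.
Proof.
move=> uv neq.
have d0 : 0 < (u - v) ^+ 2 by rewrite exprn_even_gt0 //= subr_eq0.
have -> : u / (u - v) = (u * (u - v)) / (u - v) ^+ 2 by field; rewrite subr_eq0.
have u2 := sqr_ge0 u; have v2 := sqr_ge0 v.
have num_ge0 : 0 <= u * (u - v) by nra.
by rewrite (divr_ge0 num_ge0 (ltW d0)) ler_pdivrMr // mul1r; nra.
Qed.

(** Each line meets the other segment at the zero of its [orient] function;
    these two points agree, being the intersection of the two lines. *)
Lemma crossing_meet a b c d : crossing a b c d ->
  segment a b `&` segment c d !=set0.
Proof.
case/and3P=> ab cd neq.
have e := orient_cross a b c d.
have neq' : orient c d a != orient c d b by rewrite -subr_eq0 e subr_eq0 eq_sym.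
set t := orient c d a / (orient c d a - orient c d b).
set s := orient a b c / (orient a b c - orient a b d).
exists ((1 - t) * a.1 + t * b.1, (1 - t) * a.2 + t * b.2).
split; apply/segmentP.
  by exists t => //; apply: zero_parameter01.
exists s; first exact: zero_parameter01.
rewrite /t /s e; move: neq; rewrite -subr_eq0 /orient /= => h.
by congr (_, _); field; rewrite ?h // -oppr_eq0 opprB h.
Qed.

(** * Polygonal paths *)

Fixpoint polyline p (s : seq (R * R)) : set (R * R) :=
  if s is q :: s' then segment p q `|` polyline q s' else [set p].

Lemma polyline_vertex p s q : q \in p :: s -> polyline p s q.
Proof.
elim: s p => [|q' s IHs] p /=; first by rewrite inE => /eqP.
rewrite inE => /predU1P[->|/IHs]; last by right.
by left; exact: segment_left.
Qed.

Lemma connected_polyline p s : connected (polyline p s).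
Proof.
elim: s p => [|q s IHs] p /=; first exact: connected1.
apply: connectedU => //; last exact: connected_segment.
exists q; split; first exact: segment_right.
by apply: polyline_vertex; rewrite mem_head.
Qed.

(** A path with a single vertex passes the test vacuously, hence the bound on
    the size; any other path is the union of its sides. *)
Lemma path_separated_disjoint a b p s : (0 < size s)%N ->
  path (fun q r => separated_segments q r a b) p s ->
  polyline p s `&` segment a b = set0.
Proof.
elim: s p => // q s IHs p _ /= /andP[/separated_disjoint pq qs].
rewrite setIUl pq set0U; case: s IHs qs => [_ _|r s IHs qs]; last exact: IHs.
by apply: subsetI_eq0 pq => // _ ->; exact: segment_right.
Qed.

Lemma path_crossing_meet a b p s :
  ~~ path (fun q r => ~~ crossing q r a b) p s ->
  polyline p s `&` segment a b !=set0.
Proof.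
elim: s p => // q s IHs p /=; rewrite negb_and negbK.
by case/orP=> [/crossing_meet|/IHs] [x [? ?]]; exists x; split; [left| |right|].
Qed.

(** * Representations with a single polygonal obstacle *)

Section Drawings.
Variables (G : sgraph) (pos : vertex G -> R * R).

(** From a point below the whole drawing the vertical segments going down stay
    in the complement, so its component is unbounded; a connected obstacle
    through that point stays in the same component. *)
Lemma outside_of_below (O : set (R * R)) p :
  (forall v, 0 < (pos v).2) -> connected O -> O `&` drawing pos = set0 ->
  O p -> p.2 <= 0 -> outside_obstacle pos O.
Proof.
move=> pos0 cO Od Op p0.
have below q : q.2 <= 0 -> (~` drawing pos) q.
  move=> q0 [[v qv]|[u [v [_ /segment_snd_gt0 uvq]]]].
    by move: q0; rewrite qv leNgt pos0.
  by move: q0; rewrite leNgt uvq.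
exists p; split; first exact: below.
- case=> M [_ /(_ (`|M| + 1))]; rewrite ltr_pwDr ?ler_norm // => /(_ isT) bM.
  (* The second coordinate of q is at most - (`|M| + 2). *)
  set q := (p.1, p.2 - (`|M| + 2)).
  have Mge0 := normr_ge0 M.
  have q0 : q.2 <= 0 by rewrite /q /=; lra.
  have : connected_component (~` drawing pos) p q.
    apply: (connected_component_max (segment_left p q)) (segment_right p q).
      by move=> r /segment_snd_le0 pqr; apply: below; apply: pqr.
    exact: connected_segment.
  move/bM; rewrite /= prod_normE /= ge_max => /andP[_].
  by rewrite ler0_norm // opprB => normq; move: p0 normq; rewrite /q /=; lra.
- apply: connected_component_max => // x Ox dx.
  by have : (O `&` drawing pos) x by []; rewrite Od.
Qed.

Lemma polyline_representation p s : (0 < size s)%N ->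
  injective pos -> (forall u : vertex G, exists v, edge u v) ->
  (forall u v : vertex G, edge u v ->
     path (fun q r => separated_segments q r (pos u) (pos v)) p s) ->
  (forall u v : vertex G, u != v -> ~~ edge u v ->
     ~~ path (fun q r => ~~ crossing q r (pos u) (pos v)) p s) ->
  obstacle_representation pos (fun _ : 'I_1 => polyline p s).
Proof.
move=> s0 inj_pos no_isolated sepE crossN; split=> //.
- by move=> _; exact: connected_polyline.
- move=> _; rewrite -subset0 => x [sx [[u xu]|[u [v [uv uvx]]]]].
    have [v uv] := no_isolated u.
    rewrite -(path_separated_disjoint s0 (sepE u v uv)); split => //.
    by rewrite xu; exact: segment_left.
  by rewrite -(path_separated_disjoint s0 (sepE u v uv)); split.
- by move=> u v uv nuv; exists ord0; apply: path_crossing_meet; exact: crossN.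
Qed.

Lemma no_representation0 (u v : vertex G) (obs : 'I_0 -> set (R * R)) :
  u != v -> ~~ edge u v -> ~ obstacle_representation pos obs.
Proof. by move=> uv nuv [_ _ _ h]; have [[]] := h _ _ uv nuv. Qed.

End Drawings.

End Segments.

Lemma least_eq1 (P : set nat) : ~ P 0%N -> P 1%N -> least P = 1%N.
Proof.
move=> P0 P1; apply: xget_unique; first by split=> // -[|j] // /P0.
by move=> k [Pk /(_ _ P1)]; case: k Pk => [|[|k]].
Qed.

(** * Transfer from binary integers *)

Section Embedding.
Variable R : realType.
Implicit Types (y z : Z) (a b c d : Z * Z).

Definition embedZ z : R := (int_of_Z z)%:~R.

Definition embedZ2 a : R * R := (embedZ a.1, embedZ a.2).

Lemma embedZ_gt0 z : (0 < embedZ z) = (0 < z).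
Proof.
by rewrite /embedZ ltr0z -[in RHS](int_of_ZK z) Instances.Z_of_intE ltr0z.
Qed.

Lemma embedZ_le0 z : (embedZ z <= 0) = (z <= 0).
Proof. by rewrite !leNgt embedZ_gt0. Qed.

Lemma embedZM : {morph embedZ : y z / y * z}.
Proof. by move=> y z; rewrite /embedZ !rmorphM. Qed.

Lemma embedZ_inj : injective embedZ.
Proof. by move=> y z /intr_inj/(can_inj int_of_ZK). Qed.

Lemma embedZ2_inj : injective embedZ2.
Proof. by move=> [a1 a2] [b1 b2] [/embedZ_inj-> /embedZ_inj->]. Qed.

Lemma orient_embed a b c :
  orient (embedZ2 a) (embedZ2 b) (embedZ2 c) = embedZ (orient a b c).
Proof. by rewrite /orient /embedZ /= !(rmorphB, rmorphM). Qed.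

Lemma separated_segments_embed a b c d :
  separated_segments (embedZ2 a) (embedZ2 b) (embedZ2 c) (embedZ2 d) =
  separated_segments a b c d.
Proof. by rewrite /separated_segments !orient_embed -!embedZM !embedZ_gt0. Qed.

Lemma crossing_embed a b c d :
  crossing (embedZ2 a) (embedZ2 b) (embedZ2 c) (embedZ2 d) = crossing a b c d.
Proof.
by rewrite /crossing !orient_embed -!embedZM !embedZ_le0 (inj_eq embedZ_inj).
Qed.

End Embedding.

(** * The drawing of the dodecahedron *)

(** Placed in the upper half-plane, as [outside_of_below] wants it. *)
Definition dodecahedron_points : seq (Z * Z) :=
  [:: (52, 65); (65, 68); (22, 13); (60, 51); (55, 33);
     (34, 70); (38, 53); (9, 56); (11, 19); (83, 65);
     (59, 18); (68, 1); (24, 56); (74, 48); (64, 37);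
     (2, 28); (5, 34); (1, 3); (0, 22); (71, 44)].

Definition obstacle_start : Z * Z := (13, 25).

Definition obstacle_points : seq (Z * Z) :=
  [:: (5, 2); (14, 19); (38, -1); (33, 15);
     (71, -2); (53, 37); (61, 14); (61, 39); (83, 9);
     (72, 47); (84, 39); (84, 77); (59, 43); (74, 66);
     (56, 49); (75, 79); (56, 68); (31, 71); (37, 38);
     (21, 45); (41, 55); (6, 69); (8, 33); (0, 74);
     (2, 23)].

(** The quantifiers range over the numerals [iota 0 20] rather than over the
    ordinals because the enumeration of the latter does not evaluate well. *)
Lemma drawing_certificate :
  let V := iota 0 20 in let P := nth 0 dodecahedron_points in
  let adjacent x y := has (side_of x y) dodecahedron_faces in
  [&& uniq dodecahedron_points, all (fun a => 0 < a.2) dodecahedron_points,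
    all (fun x => has (adjacent x) V) V &
    all (fun x => all (fun y =>
      if adjacent x y then
        path (fun q r => separated_segments q r (P x) (P y))
          obstacle_start obstacle_points
      else (x == y) ||
        ~~ path (fun q r => ~~ crossing q r (P x) (P y))
             obstacle_start obstacle_points) V) V].
Proof. by vm_compute. Qed.

Lemma all_iota (P : pred nat) n : all P (iota 0 n) -> forall i : 'I_n, P i.
Proof. by move=> /allP aP i; apply: aP; rewrite mem_iota add0n ltn_ord. Qed.

Section Representation.
Variable R : realType.

Definition dodecahedron_pos (v : 'I_20) : R * R :=
  embedZ2 R (nth 0 dodecahedron_points v).

Definition path_obstacle : set (R * R) :=
  polyline (embedZ2 R obstacle_start) (map (embedZ2 R) obstacle_points).

Lemma dodecahedron_representation :
  obstacle_representation (G := dodecahedron) dodecahedron_pos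
    (fun _ : 'I_1 => path_obstacle).
Proof.
have /and4P[uniqP _ nbr /all_iota chk] := drawing_certificate.
apply: polyline_representation.
- by rewrite size_map.
- by move=> u v /embedZ2_inj/eqP; rewrite nth_uniq // => /eqP/val_inj.
- move=> u; move/all_iota: nbr => /(_ u)/hasP[y]; rewrite mem_iota => yV uy.
  by exists (Ordinal yV : 'I_20).
- move=> u v uv; have /all_iota/(_ v) := chk u.
  rewrite ifT // path_map; congr (is_true _); apply: eq_path => p q.
  by rewrite /= separated_segments_embed.
- move=> u v uv nuv; have /all_iota/(_ v) := chk u.
  rewrite ifN // -[(_ == _)%N]/(u == v) (negbTE uv) path_map.
  congr (is_true (~~ _)); apply: eq_path => p q.
  by rewrite /= crossing_embed.
Qed.

End Representation.

Theorem proposition5p4 (R : realType) :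
  obstacle_number R dodecahedron = 1%N /\
  outside_obstacle_number R dodecahedron = 1%N.
Proof.
have rep := dodecahedron_representation R.
have no0 : ~ has_obstacle_rep R dodecahedron 0.
  move=> [pos [obs]].
  (* The vertices 0 and 2 are at distance two on the top face. *)
  by apply: (@no_representation0 _ dodecahedron _ ord0 (@Ordinal 20 2 isT)).
have num : obstacle_number R dodecahedron = 1%N.
  apply: least_eq1 => //.
  by exists (@dodecahedron_pos R), (fun=> @path_obstacle R).
split; first exact: num.
rewrite /outside_obstacle_number num /=; apply: least_eq1.
  by move=> [pos [obs [rep0 _]]]; apply: no0; exists pos, obs.
exists (@dodecahedron_pos R), (fun=> @path_obstacle R).
split => //; exists ord0.
have [_ obs_connected obs_free _] := rep.
have /and4P[_ /all_nthP above _ _] := drawing_certificate.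
(* This vertex of the path lies below the horizontal axis. *)
apply: (@outside_of_below _ _ _ _ (embedZ2 R (nth 0 obstacle_points 2))).
- by move=> v; rewrite embedZ_gt0 above.
- exact: obs_connected ord0.
- exact: obs_free ord0.
- by apply: polyline_vertex; rewrite inE orbC map_f // mem_nth.
- by rewrite embedZ_le0.
Qed.
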